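(* Let $(G,+)$ be an abelian group. For every pair of nonempty finite subsets $A, B \subseteq G$ with $|A| = |B|$ and $A \cap (A+B) = \emptyset$, where $A+B=\{a+b : a\in A, b\in B\}$, there exists an acyclic matching from $A$ to $B$. In other words, every abelian group possesses the weak acyclic matching property.
   Context: Let $(G,+)$ be an abelian group and $A, B \subseteq G$ nonempty finite subsets. A matching from $A$ to $B$ is a bijection $f : A \to B$ such that $a + f(a) \notin A$ for every $a \in A$. For a matching $f$, its multiplicity function $m_f : G \to \mathbb{Z}_{\geq 0}$ is $m_f(x) = |\{a \in A : a + f(a) = x\}|$. A matching $f : A \to B$ is acyclic if for every matching $g : A \to B$, $m_f = m_g$ implies $f = g$. An abelian group $G$ has the weak acyclic matching property if for all nonempty finite $A, B \subseteq G$ with $|A| = |B|$ and $A \cap (A+B) = \emptyset$, there exists an acyclic matching from $A$ to $B$. *)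

(* Defs.v *)
From mathcomp Require Import all_boot all_order all_algebra.
From mathcomp Require Import finmap.

Set Implicit Arguments.
Unset Strict Implicit.
Unset Printing Implicit Defensive.

Import GRing.Theory.
Local Open Scope fset_scope.
Local Open Scope ring_scope.

Definition sumset (G : zmodType) (A B : {fset G}) : {fset G} :=
  [fset a + b | a in A, b in B].

(* A map from A to B is a finite function between the finite types of elements
   of A and B; [val] is the inclusion into G. *)
Definition matching (G : zmodType) (A B : {fset G}) (f : {ffun A -> B}) : Prop :=
  bijective f /\ forall a : A, val a + val (f a) \notin A.

Definition multiplicity (G : zmodType) (A B : {fset G}) (f : {ffun A -> B})
    (x : G) : nat :=
  #|[set a : A | val a + val (f a) == x]|.

Definition acyclic_matching (G : zmodType) (A B : {fset G})
    (f : {ffun A -> B}) : Prop :=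
  matching f /\
  forall g : {ffun A -> B},
    matching g -> multiplicity f =1 multiplicity g -> f = g.

Definition weak_acyclic_matching_property (G : zmodType) : Prop :=
  forall A B : {fset G},
    A != fset0 -> B != fset0 -> #|` A| = #|` B| ->
    A `&` sumset A B = fset0 ->
    exists f : {ffun A -> B}, acyclic_matching f.

(* Main.v *)
Require Import Defs.
From mathcomp Require Import all_boot all_order all_algebra.
From mathcomp Require Import finmap.

(** Since [A] is disjoint from [A + B], every bijection from [A] to [B] is a
    matching.  Choose any [x] in [A + B] and match every [a] such that [x - a]
    lies in [B] with [x - a].  A bijection with the same multiplicity at [x]
    must do the same, because [x] is already attained as often as possible.
    Remove the matched elements and recurse. *)

Set Implicit Arguments.
Unset Strict Implicit.
Unset Printing Implicit Defensive.

Import GRing.Theory.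

(** The group enters only through cancellation, so the sum is replaced by a colour [c a b] injective
    in each argument. Letting [P] and [Q] range over subsets of fixed types allows matched elements
    to be deleted during the induction; [u0] gives the total maps a value off [P]. *)
Lemma exists_inj_determined_by_color_counts (T U : finType) (X : eqType)
    (c : T -> U -> X) (u0 : U) :
    (forall a, injective (c a)) -> (forall b, injective (c^~ b)) ->
  forall (P : {set T}) (Q : {set U}), #|P| = #|Q| ->
  exists f : T -> U,
    [/\ {in P &, injective f}, {in P, forall a, f a \in Q} &
      forall g : T -> U, {in P &, injective g} -> {in P, forall a, g a \in Q} ->
        (forall x, #|[set a in P | c a (f a) == x]| =
                   #|[set a in P | c a (g a) == x]|) ->
        {in P, f =1 g}].
Proof.
move=> c_injr c_injl P; have [n] := ubnP #|P|.
elim: n P => // n IHn P; rewrite ltnS => leP Q eqPQ.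
have [->|[a0 a0P]] := set_0Vmem P.
  by exists (fun=> u0); split=> [a|a|g _ _ _ a]; rewrite inE.
have /card_gt0P[b0 b0Q] : 0 < #|Q| by rewrite -eqPQ (cardD1 a0) a0P.
pose x := c a0 b0.
pose h a := odflt u0 [pick b in Q | c a b == x].
pose P1 := [set a in P | [exists b in Q, c a b == x]].
have inP1 a : (a \in P1) = (a \in P) && [exists b in Q, c a b == x].
  by rewrite inE.
clearbody P1.
have hP a : a \in P1 -> h a \in Q /\ c a (h a) = x.
  rewrite inP1 /h => /andP[_ /exists_inP[b bQ cb]].
  by case: pickP => [b' /andP[? /eqP]|/(_ b)] //; rewrite bQ cb.
(* Two points of [P1] with the same image under [h] give that image the same colour [x]. *)
have h_inj : {in P1 &, injective h}.
  move=> a a' /hP[_ ha] /hP[_ ha'] eqh.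
  by apply: (c_injl (h a)); rewrite /= ha eqh ha'.
have sP1P : P1 \subset P by apply/subsetP=> a; rewrite inP1 => /andP[].
have sQ1Q : h @: P1 \subset Q.
  by apply/subsetP=> _ /imsetP[a /hP[? _] ->].
(* The choice of [x] as an attained colour makes [P1] nonempty, so the induction descends. *)
have a0P1 : a0 \in P1 by rewrite inP1 a0P; apply/exists_inP; exists b0.
have ltP : #|P :\: P1| < n.
  apply: leq_trans leP; apply: proper_card; rewrite properEneq subsetDl andbT.
  by apply/eqP=> /setP/(_ a0); rewrite in_setD a0P a0P1.
have eqPQ' : #|P :\: P1| = #|Q :\: h @: P1|.
  by rewrite !cardsDS // card_in_imset // eqPQ.
have [f' [f'_inj f'Q f'P]] := IHn _ ltP _ eqPQ'.
pose f a := if a \in P1 then h a else f' a.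
have f1 a : a \in P1 -> f a = h a by rewrite /f => ->.
have f2 a : a \in P :\: P1 -> f a = f' a by rewrite /f inE => /andP[/negPf->].
have split_P a : a \in P -> a \in P1 \/ a \in P :\: P1.
  by move=> aP; rewrite in_setD aP andbT; case: (a \in P1); [left|right].
have f_sep a a' : a \in P1 -> a' \in P :\: P1 -> f a <> f a'.
  move=> aP1 a'P'; rewrite f1 // f2 // => eqh.
  by have := f'Q _ a'P'; rewrite -eqh inE imset_f.
exists f; split=> [a a' /split_P[]aP /split_P[]a'P| a /split_P[]aP|].
- by rewrite !f1 //; apply: h_inj.
- by move/f_sep => /(_ aP a'P).
- by move/esym/f_sep => /(_ a'P aP).
- by rewrite !f2 //; apply: f'_inj.
- by rewrite f1 //; case: (hP _ aP).
- by rewrite f2 //; have := f'Q _ aP; rewrite inE => /andP[].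
move=> g g_inj gQ eqm.
have fx a : a \in P1 -> c a (f a) = x.
  by move=> aP1; rewrite f1 //; case: (hP _ aP1).
(* Any map into [Q] takes colour [x] only inside [P1], while [f] takes it on all of [P1]; equal
   counts leave [g] no choice. *)
have gx : [set a in P | c a (g a) == x] = P1.
  apply/eqP; rewrite eqEcard -eqm; apply/andP; split.
    apply/subsetP=> a; rewrite inE inP1 => /andP[aP ga]; rewrite aP.
    by apply/exists_inP; exists (g a); first exact: gQ.
  apply/subset_leq_card/subsetP=> a aP1.
  by rewrite inE (subsetP sP1P) //= fx.
have fg1 a : a \in P1 -> f a = g a.
  move=> aP1; apply: (c_injr a); rewrite fx //.
  by move: aP1; rewrite -gx inE => /andP[_ /eqP].
have sub' a : a \in P :\: P1 -> a \in P by rewrite inE => /andP[].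
(* The counts over [P1], where [f] and [g] agree, will cancel and leave the count hypothesis for
   [f']. *)
have count_split (k : T -> U) y : #|[set a in P | c a (k a) == y]| =
    #|[set a in P1 | c a (k a) == y]| + #|[set a in P :\: P1 | c a (k a) == y]|.
  rewrite -(cardsID P1 [set a in P | _]); congr (_ + _); apply: eq_card => a.
    rewrite !inE andbAC.
    by case: (boolP (a \in P1)) => [/(subsetP sP1P)->|]; rewrite ?andbF.
  by rewrite !inE andbA.
move=> a /split_P[/fg1 //|aP']; rewrite f2 //; apply: f'P => //.
- by move=> b b' /sub' bP /sub' b'P; apply: g_inj.
(* The values in [h @: P1] are already used by [g] on [P1], so injectivity keeps [g] away from them
   on the rest of [P]. *)
- move=> b bP'; rewrite in_setD gQ ?sub' // andbT.
  apply/imsetP=> -[b' b'P1]; rewrite -f1 // fg1 // => /g_inj eqb.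
  move: bP'; rewrite in_setD => /andP[/negP nb bP]; apply: nb.
  by rewrite eqb // (subsetP sP1P).
move=> y; have := eqm y; rewrite !count_split.
have -> : [set b in P1 | c b (f b) == y] = [set b in P1 | c b (g b) == y].
  by apply/setP=> b; rewrite !in_set; case: (boolP (b \in P1)) => [/fg1->|].
move/addnI <-; apply: eq_card => b; rewrite [in LHS]inE [in RHS]inE.
by case: (boolP (b \in P :\: P1)) => [/f2->|].
Qed.

Theorem theorem2p2 (G : zmodType) : weak_acyclic_matching_property G.
Proof.
move=> A B A0 B0 eqAB dAB.
have [b0 b0B] := fset0Pn _ B0.
have card_AB : #|[set: A]| = #|[set: B]| by rewrite !cardsT -!cardfE.
(* With the sum as colour, the colour counts are the multiplicities, and both injectivity conditions
   are cancellation in [G]. *)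
pose c (a : A) (b : B) : G := (val a + val b)%R.
have c_injr a : injective (c a) by move=> b b' /addrI/val_inj.
have c_injl b : injective (c^~ b) by move=> a a' /addIr/val_inj.
have [f [f_inj _ fP]] :=
  exists_inj_determined_by_color_counts [` b0B]%fset c_injr c_injl card_AB.
exists (finfun f); split.
  split.
    apply: inj_card_bij; last by rewrite -!cardfE eqAB.
    by move=> a a'; rewrite !ffunE; apply: f_inj; rewrite inE.
  move=> a; apply/negP=> sA.
  have : (val a + val (finfun f a))%R \in (A `&` sumset A B)%fset.
    by rewrite inE sA; apply: in_imfset2 (valP a) (valP (finfun f a)).
  by rewrite dAB inE.
move=> g [/bij_inj g_inj _] eqm; apply/ffunP=> a; rewrite ffunE.
apply: (fP g); last by rewrite inE.
- by move=> b b' _ _; apply: g_inj.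
- by move=> b _; rewrite inE.
move=> x.
have := eqm x; rewrite /multiplicity => eqx.
rewrite (_ : [set b in _ | _] = [set b | (val b + val (finfun f b))%R == x]).
  by rewrite eqx; apply: eq_card => b; rewrite !inE.
by apply/setP=> b; rewrite !inE ffunE.
Qed.
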